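(* Assume CH. Let $X$ be a power-homogeneous compactum. Then $dis(X) \geq \min\{\Delta(X), \omega_3\}$.
   Context: A compactum is a compact Hausdorff space. A space $X$ is power homogeneous if $X^\kappa$ (with the product topology) is homogeneous for some cardinal $\kappa$, where a space is homogeneous if any point can be taken to any other point by a self-homeomorphism. $dis(X)$ denotes the least number of discrete sets required to cover $X$ (a subset of $X$ is discrete if its subspace topology is discrete; it need not be closed in $X$). $\Delta(X)$ denotes the least cardinality of a nonempty open subset of $X$ (for nonempty $X$). *)

(* Defs.v *)
From HB Require Import structures.
From mathcomp Require Import all_boot all_classical all_analysis.

Set Implicit Arguments.
Unset Strict Implicit.
Unset Printing Implicit Defensive.

Local Open Scope classical_set_scope.
Local Open Scope card_scope.

(* Cardinal numbers are represented by sets and compared with #<= and #=.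
   [least_card F] is a member of [F] of least cardinality, so that the least
   cardinality attained in [F] is the cardinality of this set; it is only
   meaningful when [F] is nonempty, see [least_cardP]. *)
Definition least_card {T : Type} (F : set (set T)) : set T :=
  xget set0 [set A | F A /\ forall B, F B -> A #<= B].

Lemma least_cardP (T : Type) (F : set (set T)) : F !=set0 ->
  F (least_card F) /\ forall B, F B -> least_card F #<= B.
Proof.
move=> [A0 FA0].
suff ex : exists A, F A /\ forall B, F B -> A #<= B.
  exact: (@xgetPex _ set0 [set A | F A /\ forall B, F B -> A #<= B] ex).
have [F0|F0] := pselect (F set0); first by exists set0; split.
(* A maximal family R of choice functions with pairwise distinct values at
   every member of F has a surjective projection onto some member of F. *)
pose P (R : set (set T -> T)) :=
  (forall c, R c -> forall A, F A -> A (c A)) /\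
  (forall c d, R c -> R d -> forall A, F A -> c A = d A -> c = d).
have [|R [[Rval Rinj] Rmax]] := @Zorn_bigcup _ P.
  move=> G GP Gtot; split=> [c [R GR Rc]|c d [R GR Rc] [S GS Sd]].
    exact: (GP _ GR).1.
  by have [RS|SR] := Gtot _ _ GR GS;
    [apply: (GP _ GS).2 => //; exact: RS|apply: (GP _ GR).2 => //; exact: SR].
have proj A B : F A -> F B -> A `<=` [set c A | c in R] -> A #<= B.
  move=> FA FB AR; apply: card_le_trans (subset_card_le AR) _.
  apply: card_le_trans (card_image_le _ _) _.
  have inj : {in R &, injective (fun c : set T -> T => c B)}.
    by move=> c d /set_mem Rc /set_mem Rd; exact: Rinj.
  have /card_eqPle[_ RB] := inj_card_eq inj.
  apply: card_le_trans RB (subset_card_le _) => _ [c Rc <-].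
  exact: (Rval c Rc B FB).
apply: contrapT => noex.
have miss A : exists x, F A -> A x /\ ~ [set c A | c in R] x.
  have [t _] : A0 !=set0 by apply/set0P/eqP => A0E; apply: F0; rewrite -A0E.
  have [FA|nFA] := pselect (F A); last by exists t.
  apply: contrapT => nx; apply: noex; exists A; split=> // B FB.
  apply: proj => // x Ax; apply: contrapT => nRx; apply: nx.
  by exists x.
have [c0 c0P] := choice miss.
have nR c A : F A -> R c -> c A <> c0 A.
  by move=> FA Rc cE; apply: (c0P A FA).2; exists c.
apply: (Rmax (R `|` [set c0])).
  split; first by left.
  by move=> /(_ c0 (or_intror erefl)) Rc0; exact: (nR c0 A0).
split=> [c [Rc|->] A FA|c d [Rc|->] [Rd|->] A FA cd //].
- exact: (Rval c Rc A FA).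
- exact: (c0P A FA).1.
- exact: (Rinj c d Rc Rd A FA).
- by case: (nR c A).
- by case: (nR d A).
Qed.

Lemma card_le_total (T U : Type) (A : set T) (B : set U) :
  A #<= B \/ B #<= A.
Proof.
have lE : @inl T U @` A #= A by apply: inj_card_eq => x y _ _ [].
have rE : @inr T U @` B #= B by apply: inj_card_eq => x y _ _ [].
have [|lF lmin] := @least_cardP _ [set inl @` A; inr @` B].
  by exists (inl @` A); left.
have := lmin _ (or_intror erefl); have := lmin _ (or_introl erefl).
case: lF => -> hl hr; [left|right].
  by rewrite -(card_le_eql lE) -(card_le_eqr rE).
by rewrite -(card_le_eql rE) -(card_le_eqr lE).
Qed.

Definition card_min {T U : Type} (A : set T) (B : set U) : set (T + U) :=
  if A #<= B then inl @` A else inr @` B.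

Lemma card_min_le (T U V : Type) (A : set T) (B : set U) (C : set V) :
  (card_min A B #<= C) = (A #<= C) || (B #<= C).
Proof.
have lE : @inl T U @` A #= A by apply: inj_card_eq => x y _ _ [].
have rE : @inr T U @` B #= B by apply: inj_card_eq => x y _ _ [].
rewrite /card_min; case: ifPn => AB.
  rewrite (card_le_eql lE); apply/idP/orP => [->|[]//]; first by left.
  exact: card_le_trans.
rewrite (card_le_eql rE); apply/idP/orP => [->|[]//]; first by right.
by have [/(negP AB)|BA] := card_le_total A B => //; exact: card_le_trans.
Qed.

(* The successor cardinal; it is at most the cardinality of the power set, so
   it can be sought among the subsets of [set T], see [card_succ_le]. *)
Definition card_succ {T : Type} (A : set T) : set (set T) :=
  least_card [set B : set (set T) | ~ (B #<= A)].

Lemma cantor_card (T : Type) (A : set T) : ~ ([set: set T] #<= A).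
Proof.
move=> /card_le_trans/(_ (card_leT A)) /card_leP[f].
pose g (B : set T) : T := val (f (to_setT B)).
have ginj : injective g.
  move=> B C /val_inj /(inj (mem_set I) (mem_set I)).
  by move/(congr1 val).
pose D := [set g B | B in [set B : set T | ~ B (g B)]].
have [DgD|nDgD] := pselect (D (g D)); last by apply: (nDgD); exists D.
by have [B nB /ginj BD] := DgD; apply: nB; rewrite BD.
Qed.

Lemma card_succ_nle (T : Type) (A : set T) : ~ (card_succ A #<= A).
Proof.
by apply: (@least_cardP _ [set B | ~ (B #<= A)] _).1; exists setT;
  exact: cantor_card.
Qed.

Lemma card_succ_le (T U : Type) (A : set T) (B : set U) :
  ~ (B #<= A) -> card_succ A #<= B.
Proof.
move=> BA; have [TB|BT] := card_le_total [set: set T] B.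
  exact: card_le_trans (card_leT _) TB.
have /pcard_leP[f] := BT.
have fE := card_image f.
rewrite -(card_le_eqr fE); apply: (@least_cardP _ [set C | ~ (C #<= A)] _).2.
  by exists setT; exact: cantor_card.
by rewrite /= (card_le_eql fE).
Qed.

(* [omega n] has cardinality aleph_n. *)
Fixpoint omega_carrier (n : nat) : Type :=
  if n is m.+1 then set (omega_carrier m) else nat.

Fixpoint omega (n : nat) : set (omega_carrier n) :=
  match n return set (omega_carrier n) with
  | 0 => [set: nat]
  | m.+1 => card_succ (@omega m)
  end.
Arguments omega n : clear implicits.

Definition CH : Prop := [set: set nat] #= omega 1.

Definition compactum (X : topologicalType) : Prop :=
  compact [set: X] /\ hausdorff_space X.

Definition homeomorphism (X Y : topologicalType) (f : X -> Y) : Prop :=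
  continuous f /\
  exists g : Y -> X, [/\ continuous g, cancel f g & cancel g f].

Definition homogeneous (X : topologicalType) : Prop :=
  forall x y : X, exists2 h : X -> X, homeomorphism h & h x = y.

(* The exponent is a nonzero cardinal: the empty power of any space is a point,
   hence homogeneous. [prod_topology] is the Tychonoff product. *)
Definition power_homogeneous (X : topologicalType) : Prop :=
  exists I : Type,
    inhabited I /\ homogeneous (prod_topology (fun _ : I => X)).

(* [set_type D] carries the topology induced by [X]. *)
Definition discrete_subset (X : topologicalType) (D : set X) : Prop :=
  @nbhs (set_type D) (set_type D) = principal_filter.

(* A cover of least cardinality by discrete sets, whose cardinality is the
   cardinal dis(X). *)
Definition dis (X : topologicalType) : set (set X) :=
  least_card [set C : set (set X) |
    (forall D, C D -> discrete_subset D) /\ \bigcup_(D in C) D = [set: X]].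
Arguments dis X : clear implicits.

(* A nonempty open set of least cardinality, whose cardinality is the cardinal
   Delta(X). *)
Definition Delta (X : topologicalType) : set X :=
  least_card [set U : set X | open U /\ U !=set0].
Arguments Delta X : clear implicits.

Lemma discrete_subsetP (X : topologicalType) (D : set X) :
  discrete_subset D <->
  forall x, D x -> exists2 U, open U & U `&` D = [set x].
Proof.
split=> [dD x Dx|iso].
  have : nbhs (SigSub (mem_set Dx) : set_type D) [set SigSub (mem_set Dx)].
    by rewrite dD => y ->.
  rewrite nbhsE => -[V [[U oU UV] Vx] Vsub].
  exists U => //; apply/seteqP; split=> [y [Uy Dy]|_ ->].
    have : V (SigSub (mem_set Dy)) by rewrite -UV.
    by move/Vsub => /(congr1 val).
  by split=> //; move: Vx; rewrite -UV.
apply/funext => -[x Dx]; apply/seteqP; split=> V.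
  by move=> /nbhs_singleton Vx y ->.
move=> Vx; have [U oU UD] := iso x (set_mem Dx).
have [Ux _] : (U `&` D) x by rewrite UD.
rewrite nbhsE; exists (set_val @^-1` U); first by split=> //; exists U.
move=> [y Dy] /= Uy; apply: Vx; apply: val_inj => /=.
by have : (U `&` D) y by [split=> //; exact: set_mem]; rewrite UD => ->.
Qed.

Lemma disP (X : topologicalType) :
  [/\ forall D, dis X D -> discrete_subset D,
      \bigcup_(D in dis X) D = [set: X] &
      forall C : set (set X), (forall D, C D -> discrete_subset D) ->
        \bigcup_(D in C) D = [set: X] -> dis X #<= C].
Proof.
have [|[d1 d2] dmin] := @least_cardP _ [set C : set (set X) |
    (forall D, C D -> discrete_subset D) /\ \bigcup_(D in C) D = [set: X]].
  exists (range set1); split=> [_ [x _ <-]|].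
    apply/discrete_subsetP => _ ->; exists setT; first exact: openT.
    by rewrite setTI.
  by apply/seteqP; split=> // x _; exists [set x] => //; exists x.
by split=> // C C1 C2; exact: dmin.
Qed.

Lemma DeltaP (X : topologicalType) : [set: X] !=set0 ->
  [/\ open (Delta X), Delta X !=set0 &
      forall U : set X, open U -> U !=set0 -> Delta X #<= U].
Proof.
move=> X0; have [|[d1 d2] dmin] :=
    @least_cardP _ [set U : set X | open U /\ U !=set0].
  by exists setT; split=> //; exact: openT.
by split=> // U oU U0; exact: dmin.
Qed.

(* Main.v *)
(* Call H_K the property that every nonempty closed subset of X has a point of
   character at most |K| relative to it.

   If H_K fails, the Cech-Pospisil tree of height |K|^+ produces 2^(|K|^+)
   disjoint nonempty closed sets, each an intersection of members of a family of
   at most |K|^+ * 2^|K| closed sets.  By Gruenhage's lemma, a cover of X by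
   discrete sets assigns to these sets distinct codes: finitely many members of
   the cover and of the family.  Hence 2^(|K|^+) <= max (dis X, |K|^+, 2^|K|).

   If H_K holds and X is power homogeneous, then every point of X has character
   at most |K|: otherwise a homeomorphism of X^I moving a constant point of small
   character yields an independent family of more than |K| pairs of closed sets
   in X, and a closed set mapping irreducibly onto the corresponding Cantor cube
   contradicts H_K.  By Arhangel'skii's theorem |X| <= 2^|K|.

   Under CH it suffices to use these facts for K = omega and K = 2^omega = omega_1;
   dis X >= omega_1 is the Baire category theorem unless X has an isolated
   point, in which case Delta X = 1. *)
From Stdlib Require List.
Require Import Defs.
From mathcomp Require Import all_boot all_classical all_analysis.

Set Implicit Arguments.
Unset Strict Implicit.
Unset Printing Implicit Defensive.

Local Open Scope classical_set_scope.
Local Open Scope card_scope.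

(** * Cardinality of types *)

(** Types are compared rather than sets, so that products, lists and power sets are formed freely;
    [card_leE] and [card_leTE] link this to [#<=]. *)
Definition tle (T U : Type) : Prop := exists f : T -> U, injective f.

Lemma tle_refl T : tle T T.
Proof. by exists id. Qed.

Lemma tle_trans U T V : tle T U -> tle U V -> tle T V.
Proof. by move=> [f fI] [g gI]; exists (g \o f); exact: inj_comp. Qed.

Lemma tle_prod T T' U U' : tle T T' -> tle U U' -> tle (T * U) (T' * U').
Proof.
move=> [f fI] [g gI]; exists (fun p => (f p.1, g p.2)).
by move=> [a b] [c d] [/fI -> /gI ->].
Qed.

Lemma tle_seq T U : tle T U -> tle (seq T) (seq U).
Proof. by move=> [f fI]; exists (map f); exact: inj_map. Qed.

Lemma tle_set T U : tle T U -> tle (set T) (set U).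
Proof.
move=> [f fI]; exists (fun A => f @` A) => A B AB; apply/seteqP; split=> x Ax.
  by have : (f @` B) (f x) by [rewrite -AB; exists x]; move=> [y By /fI <-].
by have : (f @` A) (f x) by [rewrite AB; exists x]; move=> [y By /fI <-].
Qed.

Lemma sval_inj (T : Type) (P : T -> Prop) : injective (@sval T P).
Proof. by move=> -[x Px] [y Py] /= xy; exact: eq_exist. Qed.

Lemma tle_subset (T : Type) (P : T -> Prop) : tle {x | P x} T.
Proof. by exists sval; exact: sval_inj. Qed.

Lemma tle_surj T U (f : T -> U) : (forall u, exists t, f t = u) -> tle U T.
Proof.
by move=> /choice[g gK]; exists g; exact: can_inj gK.
Qed.

Lemma tle_enum T U (u0 : U) : tle U T ->
  exists f : T -> U, forall u, exists t, f t = u.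
Proof.
move=> [g gI].
have h t : exists u, forall v, g v = t -> v = u.
  have [[u <-]|nt] := pselect (exists u, g u = t); first by exists u => v /gI.
  by exists u0 => v gv; case: nt; exists v.
have [f fP] := choice h.
by exists f => u; exists (g u); rewrite -(fP (g u) u).
Qed.

Lemma card_leE T U (A : set T) (B : set U) : (A #<= B) <-> tle A B.
Proof.
split=> [/card_leP[f]|[f fI]].
  by exists f => x y; apply: inj; rewrite inE.
have fIn : {in [set: A] &, injective f} by move=> ? ? _ _; exact: fI.
have := inj_card_eq fIn => /card_eqPle[_ le].
have := card_le_trans le (card_leT _).
have eqT V (C : set V) : C #= [set: C].
  have vI : {in [set: C] &, injective (val : C -> V)} by move=> ? ? _ _; exact: val_inj.
  have /card_esym := inj_card_eq vI; rewrite card_eq_sym.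
  have -> // : val @` [set: C] = C.
  apply/seteqP; split=> [_ [x _ <-]|x Cx]; first exact: set_valP.
  by exists (SigSub (mem_set Cx)).
by rewrite -(card_le_eqr (eqT _ _)) -(card_le_eql (eqT _ _)).
Qed.

Lemma card_leTE T U : ([set: T] #<= [set: U]) <-> tle T U.
Proof.
have le V : tle V [set: V] /\ tle [set: V] V.
  split; first by exists (fun x => SigSub (mem_set (I : setT x))) => x y /(congr1 val).
  by exists val; exact: val_inj.
split=> [/card_leE h|h]; last apply/card_leE.
  exact: tle_trans (le T).1 (tle_trans h (le U).2).
exact: tle_trans (le T).2 (tle_trans h (le U).1).
Qed.

Lemma tle_total T U : tle T U \/ tle U T.
Proof.
by have [/card_leTE|/card_leTE] := card_le_total [set: T] [set: U]; [left|right].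
Qed.

Lemma cantor_tle T : ~ tle (set T) T.
Proof. by move=> /card_leTE; exact: cantor_card. Qed.

Lemma tle_singletons T : tle T (set T).
Proof.
exists set1 => x y xy; have : [set x] x by []. by rewrite xy.
Qed.

(** A list is coded by its length and the iterated pairing of its entries; the length is kept
    because the end marker [e 0] may itself be the code of a pair. *)
Lemma seq_tle T : tle nat T -> tle (T * T) T -> tle (seq T) T.
Proof.
move=> [e eI] TT; have [p pI] := TT.
pose code := fix code (s : seq T) : T :=
  if s is x :: s' then p (x, code s') else e 0.
apply: tle_trans TT; exists (fun s => (e (size s), code s)).
elim=> [|x s IH] [|y t] E; first by [].
- by case: E => /eI.
- by case: E => /eI.
by case: E => /eI[st] /pI[-> c]; rewrite (IH t)// st c.
Qed.

Lemma bool_tle K : tle nat K -> tle bool K.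
Proof. by apply: tle_trans; exists nat_of_bool => -[] []. Qed.

Lemma sum_tle K T U : tle nat K -> tle (K * K) K -> tle T K -> tle U K ->
  tle (T + U) K.
Proof.
move=> natK KK [f fI] [g gI].
apply: tle_trans (tle_trans (tle_prod (bool_tle natK) (tle_refl K)) KK).
exists (fun v => match v with inl t => (true, f t) | inr u => (false, g u) end).
by move=> [a|a] [b|b] // [] => [/fI|/gI] ->.
Qed.

Lemma set_square T : tle bool T -> tle (T * T) T -> tle (set T * set T) (set T).
Proof.
move=> bT TT.
apply: tle_trans (tle_set (tle_trans (tle_prod bT (tle_refl T)) TT)).
exists (fun AB => [set p | if p.1 then AB.1 p.2 else AB.2 p.2]).
move=> [A B] [C D] /= E; congr pair; apply/funext => x.
  exact: (congr1 (fun S : set (bool * T) => S (true, x)) E).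
exact: (congr1 (fun S : set (bool * T) => S (false, x)) E).
Qed.

Lemma nat_square : tle (nat * nat) nat.
Proof. by exists pickle; exact: pcan_inj pickleK. Qed.

(** * Well-orders, and squares of infinite sets *)

Lemma well_order_rel (T : Type) : exists lt : T -> T -> Prop,
  [/\ well_founded lt, forall x y, [\/ lt x y, x = y | lt y x] &
      forall x y z, lt x y -> lt y z -> lt x z].
Proof.
have [R wo] := wochoice.well_ordering_principle {classic T}.
have woT : wochoice.wo_chain R predT by move=> A _; exact: wo.
have Rtot : forall x y, R x y || R y x.
  by move=> x y; exact: (wochoice.wo_chainW woT).
have Ranti : antisymmetric R.
  by move=> x y; exact: (wochoice.wo_chain_antisymmetric woT).
have Rmin (A : set T) : A !=set0 -> exists2 z, A z & forall x, A x -> R z x.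
  move=> [a Aa]; have [|z [[Az zm] _]] := wo (fun x : {classic T} => `[< A x >]).
    by exists a; exact/asboolP.
  exists z => [|x Ax]; first exact/asboolP.
  by apply: zm; exact/asboolP.
have Rtr : transitive R.
  move=> y x z xy yz.
  have [|w wA wm] := Rmin [set u | [\/ u = x, u = y | u = z]].
    by exists x; exact: Or31.
  have wx := wm x (Or31 _ _ erefl); have wy := wm y (Or32 _ _ erefl).
  have wz := wm z (Or33 _ _ erefl).
  case: wA => Ew; move: wx wy wz; rewrite Ew // => wx wy wz.
    by have -> : x = y by apply: Ranti; rewrite xy wx.
  by have <- : y = z by apply: Ranti; rewrite yz wy.
exists (fun x y => R x y /\ x <> y); split.
- move=> x; apply: contrapT => nx.
  have [|z nz zm] := Rmin [set u | ~ Acc (fun x y => R x y /\ x <> y) u].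
    by exists x.
  apply: nz; constructor => y [yz ynz]; apply: contrapT => ny.
  by apply: ynz; apply: Ranti; rewrite yz zm.
- move=> x y; have [->|xy] := pselect (x = y); first exact: Or32.
  have /orP[h|h] := Rtot x y; first exact: Or31.
  by apply: Or33; split=> // yx; apply: xy.
- move=> x y z [xy nxy] [yz nyz]; split; first exact: Rtr yz.
  by move=> E; apply: nxy; apply: Ranti; rewrite xy/= E yz.
Qed.

Lemma wf_min (W : Type) (lt : W -> W -> Prop) (P : W -> Prop) :
    well_founded lt -> (exists w, P w) ->
  exists2 w, P w & forall v, lt v w -> ~ P v.
Proof.
move=> wf [w]; elim/(well_founded_ind wf): w => w IH Pw.
have [[v [vw Pv]]|nv] := pselect (exists v, lt v w /\ P v); first exact: IH Pv.
by exists w => // v vw Pv; apply: nv; exists v.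
Qed.

(** A well-order of [card_succ A] is cut at the least point, if any, whose initial segment does not
    inject into [A]. That segment still has the size of the successor, while its proper initial
    segments are at most [A]. *)
Lemma succ_well_order (T : Type) (A : set T) :
  exists (W : Type) (lt : W -> W -> Prop),
  [/\ [/\ well_founded lt, forall x y, [\/ lt x y, x = y | lt y x] &
          forall x y z, lt x y -> lt y z -> lt x z],
      forall w, tle {v | lt v w} A, tle W (card_succ A) &
      tle (card_succ A) W].
Proof.
have [lt [wf tot tr]] := well_order_rel (card_succ A).
have [all|/existsNP[u0 nu0]] := pselect (forall w, tle {v | lt v w} A).
  by exists (card_succ A), lt; split=> //; exact: tle_refl.
have [|u nu umin] := @wf_min _ lt (fun u => ~ tle {v | lt v u} A) wf.
  by exists u0.
exists {v | lt v u}, (fun a b => lt (sval a) (sval b)); split.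
- split=> [[v vu]|[x xu] [y yu] /=|x y z]; last exact: tr.
    elim/(well_founded_ind wf): v vu => v IH vu.
    by constructor => -[x xu] /= xv; exact: IH.
  have [?|E|?] := tot x y; first exact: Or31.
    by apply: Or32; exact: eq_exist.
  exact: Or33.
- move=> [v vu] /=; apply: tle_trans (contrapT (umin v vu)).
  exists (fun a : {x : {x | lt x u} | lt (sval x) v} =>
    exist (fun x => lt x v) (sval (sval a)) (svalP a)).
  by move=> [[a au] av] [[b bu] bv] /= [ab]; apply: eq_exist; exact: eq_exist.
- exact: tle_subset.
- have nset : ~ ([set: {v | lt v u}] #<= A).
    move=> /card_leE h; apply: nu; apply: tle_trans h.
    by exists (fun x => SigSub (mem_set (I : setT x))) => x y /(congr1 val).
  have /card_leE h := card_succ_le nset.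
  by apply: tle_trans h _; exists val; exact: val_inj.
Qed.

Lemma prod_absorb (K W : Type) : tle nat K -> tle (K * K) K -> tle K W -> tle (W * K) W.
Proof.
move=> natK KK [g0 g0I].
(* A maximal family of injections K -> W with pairwise disjoint ranges covers
   W up to a set of size at most K. *)
pose P (G : set (K -> W)) :=
  (forall g, G g -> injective g) /\
  (forall g h k l, G g -> G h -> g k = h l -> g = h).
have [|G [[Ginj Gdis] Gmax]] := @Zorn_bigcup _ P.
  move=> F FP Ftot; split=> [g [G FG Gg]|g h k l [G FG Gg] [H FH Hh]].
    exact: (FP _ FG).1.
  by have [GH|HG] := Ftot _ _ FG FH;
    [apply: (FP _ FH).2 => //; exact: GH|apply: (FP _ FG).2 => //; exact: HG].
pose Z := [set w | forall g k, G g -> g k <> w].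
have ZK : tle {w | Z w} K.
  have [//|[g gI]] := tle_total {w | Z w} K.
  pose g' k := sval (g k).
  have g'I : injective g'.
    by move=> k l /sval_inj /gI.
  have G0 : ~ G g'.
    have [e _] := natK.
    by move=> Gg; apply: (svalP (g (e 0)) g' (e 0)).
  case: (Gmax (G `|` [set g'])).
    by split; [left|move=> sub; apply: G0; apply: sub; right].
  split=> [h [/Ginj//|->//]|a b k l [Ga|->] [Gb|->] //]; first exact: Gdis Ga Gb.
    by move=> E; case: (svalP (g l) a k Ga).
  by move=> /esym E; case: (svalP (g k) b l Gb).
have [[g1 Gg1]|noG] := pselect (G !=set0); last first.
  have WK : tle W K.
    apply: tle_trans ZK.
    have ZT w : Z w by move=> g k Gg; case: noG; exists g.
    by exists (fun w => exist _ w (ZT w)) => a b [].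
  apply: tle_trans (tle_prod WK (tle_refl K)) (tle_trans KK _).
  by exists g0.
have GKW : tle ({g | G g} * K) W.
  exists (fun p => sval p.1 p.2) => -[[g Gg] k] [[h Gh] l] /= E.
  have gh := Gdis _ _ _ _ Gg Gh E; have kl : k = l.
    by apply: (Ginj _ Gh); rewrite -E gh.
  by rewrite kl; congr pair; exact: eq_exist.
have WGK : tle W ({g | G g} * K).
  have boolK := bool_tle natK.
  have step : tle W ({g | G g} * (bool * K)).
    have [z zI] := ZK.
    have Wc w : exists p : {g | G g} * (bool * K),
        (p.2.1 = false /\ sval p.1 p.2.2 = w) \/
        (p.2.1 = true /\ exists Zw : Z w, p.2.2 = z (exist _ w Zw)).
      have [Zw|] := pselect (Z w).
        exists (exist _ g1 Gg1, (true, z (exist _ w Zw))); right; split=> //.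
        by exists Zw.
      move=> /existsNP[g /existsNP[k /not_implyP[Gg /contrapT gk]]].
      by exists (exist _ g Gg, (false, k)); left.
    have [c cP] := choice Wc.
    exists c => v w E; have := cP v; have := cP w; rewrite -E.
    case=> [[-> <-]|[-> [Zw ->]]] [] [] //.
    by move=> _ [Zv /zI[]].
  apply: tle_trans step (tle_prod (tle_refl _) _).
  exact: tle_trans (tle_prod boolK (tle_refl K)) KK.
apply: tle_trans (tle_prod WGK (tle_refl K)) _.
apply: tle_trans GKW.
apply: tle_trans (tle_prod (tle_refl _) KK).
by exists (fun p => (p.1.1, (p.1.2, p.2))) => -[[a b] c] [[d e] f] [-> -> ->].
Qed.

(** A pair is coded by its larger entry, the code in [K] of the smaller one among the predecessors,
    and two bits for the order; [prod_absorb] then removes the factor [K]. *)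
Lemma well_order_square (K W : Type) (lt : W -> W -> Prop) :
    tle nat K -> tle (K * K) K -> tle K W ->
    (forall x y, [\/ lt x y, x = y | lt y x]) ->
    (forall w, tle {v | lt v w} K) ->
  tle (W * W) W.
Proof.
move=> natK KK KW tot segK.
apply: tle_trans (prod_absorb natK KK KW).
have boolK := bool_tle natK.
have absK : tle (W * ((bool * bool) * K)) (W * K).
  apply: tle_prod (tle_refl _) (tle_trans (tle_prod _ (tle_refl K)) KK).
  exact: tle_trans (tle_prod boolK boolK) KK.
have [e _] := natK.
have seg w : exists s : W -> K,
    forall x y, lt x w -> lt y w -> s x = s y -> x = y.
  have [f fI] := segK w.
  have h x : exists k, forall xw : lt x w, k = f (exist _ x xw).
    have [xw|nxw] := pselect (lt x w); last by exists (e 0).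
    by exists (f (exist _ x xw)) => xw'; rewrite (Prop_irrelevance xw xw').
  have [s sP] := choice h; exists s => x y xw yw.
  by rewrite (sP x xw) (sP y yw) => /fI[].
apply: tle_trans absK; have [s sI] := choice seg.
have code p : exists q : W * ((bool * bool) * K),
    [\/ q.2.1 = (true, true) /\ p = (q.1, q.1),
        [/\ q.2.1 = (true, false), lt p.1 p.2, q.1 = p.2 & q.2.2 = s p.2 p.1] |
        [/\ q.2.1 = (false, true), lt p.2 p.1, q.1 = p.1 & q.2.2 = s p.1 p.2]].
  case: p => x y; have [h|->|h] := tot x y.
  - by exists (y, ((true, false), s y x)); apply: Or32.
  - by exists (y, ((true, true), e 0)); apply: Or31.
  - by exists (x, ((false, true), s x y)); apply: Or33.
have [c cP] := choice code; exists c => -[x y] [x' y'] E.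
have := cP (x, y); have := cP (x', y'); rewrite -E /=.
case=> [[-> h]|[-> h -> ->]|[-> h -> ->]] [] [] //; first by move=> _ ->.
- by move=> _ h' yy'; rewrite yy' in h h' *; move/sI => ->.
- by move=> _ h' yy'; rewrite yy' in h h' *; move/sI => ->.
Qed.

(** * Compact spaces and points of small character *)

Definition capl {I X : Type} (C : I -> set X) (s : seq I) : set X :=
  [set x | forall i, List.In i s -> C i x].

Lemma capl_cons (I X : Type) (C : I -> set X) i s :
  capl C (i :: s) = C i `&` capl C s.
Proof.
apply/seteqP; split=> [x h|x [Cx h] j [<-//|]]; last exact: h.
by split=> [|j js]; apply: h; [left|right].
Qed.

Lemma capl_nil (I X : Type) (C : I -> set X) : capl C [::] = setT.
Proof. by apply/seteqP; split=> // x _ i []. Qed.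

Lemma open_capl (X : topologicalType) (I : Type) (C : I -> set X) s :
  (forall i, open (C i)) -> open (capl C s).
Proof.
move=> oC; elim: s => [|i s IH]; first by rewrite capl_nil; exact: openT.
by rewrite capl_cons; exact: openI.
Qed.

Lemma compact_fip (X : topologicalType) (I : Type) (C : I -> set X) :
    compact [set: X] -> (forall i, closed (C i)) ->
    (forall s, capl C s !=set0) ->
  exists x, forall i, C i x.
Proof.
move=> cX clC finC.
have PF : ProperFilter (filter_from [set: seq I] (capl C)).
  apply: filter_from_proper => [|s _]; last exact: finC.
  apply: filter_from_filter; first by exists [::].
  move=> s t _ _; exists (s ++ t) => // x h.
  by split=> i is_; apply: h; apply/List.in_app_iff; [left|right].
have [|x [_ xc]] := cX _ PF; first by exists [::].
exists x => i; apply: (clC i) => B Bx; apply: (xc (C i) B) => //.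
by exists [:: i] => // y; apply; left.
Qed.

Lemma In_pmap_id (T : Type) (i : T) (s : seq (option T)) :
  List.In (Some i) s -> List.In i (pmap id s).
Proof.
elim: s => //= o s IH [->|/IH h] /=; first by left.
by case: o => [j|] //=; right.
Qed.

Lemma compact_capl_sub (X : topologicalType) (I : Type) (C : I -> set X) O :
    compact [set: X] -> (forall i, closed (C i)) -> open O ->
    (forall x, (forall i, C i x) -> O x) ->
  exists s, capl C s `<=` O.
Proof.
move=> cX clC oO CO; apply: contrapT => ns.
pose C' (i : option I) := if i is Some i then C i else ~` O.
have [||x Cx] := @compact_fip X _ C' cX; last 1 first.
- by apply: (Cx None); apply: CO => i; exact: (Cx (Some i)).
- by case=> [i|]; [exact: clC|exact: open_closedC].
move=> s; apply: contrapT => s0; apply: ns.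
exists (pmap id s) => x xs; apply: contrapT => nOx; apply: s0; exists x.
move=> -[i|] //= is_; apply: xs.
exact: In_pmap_id.
Qed.

Lemma open_shrink (X : topologicalType) (x : X) (O : set X) :
    compact [set: X] -> hausdorff_space X -> open O -> O x ->
  exists V, [/\ open V, V x & closure V `<=` O].
Proof.
move=> cX hX oO Ox.
have [V Vx VO] := compact_regular hX cX filterT (open_nbhs_nbhs (conj oO Ox)).
exists V°; split; [exact: open_interior| exact: Vx|].
exact: subset_trans (closureS (@interior_subset _ V)) VO.
Qed.

Lemma separate_points (X : topologicalType) (x y : X) :
    compact [set: X] -> hausdorff_space X -> x <> y ->
  exists U V : set X, [/\ open U, open V, U x, V y &
    closure U `&` closure V = set0].
Proof.
move=> cX hX xy; have := hX; rewrite open_hausdorff => /(_ x y).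
case=> [|[A B] /= [/set_mem Ax /set_mem By] [oA oB /eqP AB]]; first exact/eqP.
have [U [oU Ux UA]] := open_shrink cX hX oA Ax.
have [V [oV Vy VB]] := open_shrink cX hX oB By.
exists U, V; split=> //; apply/seteqP; split=> // z [/UA Az /VB Bz].
by rewrite -AB.
Qed.

Lemma closed1 (X : topologicalType) (x : X) : hausdorff_space X -> closed [set x].
Proof. by move=> hX; apply: accessible_closed_set1; exact: hausdorff_accessible. Qed.

(* In a compact set [Z] this says that [z] has character at most |K| in [Z]. *)
Definition Gpoint (K : Type) (X : topologicalType) (Z : set X) (z : X) : Prop :=
  Z z /\ exists U : K -> set X, (forall k, open (U k) /\ U k z) /\
    forall y, Z y -> (forall k, U k y) -> y = z.

(** With the closure of [V k] inside [U k], the closures still meet [Z] only in [z], so by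
    compactness finitely many of them cut [Z] down to a part of [O]. The indexing by lists, monotone
    under inclusion, later serves for nets. *)
Lemma Gpoint_base (K : Type) (X : topologicalType) (Z : set X) (z : X) :
    compact [set: X] -> hausdorff_space X -> closed Z -> Gpoint K Z z ->
  exists N : seq K -> set X,
    [/\ forall s, open (N s) /\ N s z,
        forall s t, (forall k, List.In k s -> List.In k t) -> N t `<=` N s &
        forall O, open O -> O z -> exists s, Z `&` N s `<=` O].
Proof.
move=> cX hX clZ [Zz [U [oU Uz]]].
have /choice[V VP] k : exists V, [/\ open V, V z & closure V `<=` U k].
  by have [? ?] := oU k; exact: open_shrink.
exists (capl V); split.
- by move=> s; split=> [|k _]; [apply: open_capl => k|]; have [] := VP k.
- by move=> s t st x xt k /st; exact: xt.
move=> O oO Oz.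
pose C (i : option K) := if i is Some k then closure (V k) else Z.
have [||s sO] := @compact_capl_sub X _ C O cX _ oO.
- by move=> [k|] //=; exact: closed_closure.
- move=> x Cx; rewrite (Uz x) // => [|k]; first exact: (Cx None).
  by have [_ _] := VP k; apply; exact: (Cx (Some k)).
exists (pmap id s) => x [Zx xs]; apply: sO => -[k|] //= ks.
apply: subset_closure; apply: xs.
exact: In_pmap_id.
Qed.

Lemma chain_list_max (T : Type) (F : set (set T)) (s : seq (set T)) :
    total_on F subset -> s <> [::] -> (forall A, List.In A s -> F A) ->
  exists2 A, F A & forall B, List.In B s -> B `<=` A.
Proof.
move=> Ftot; elim: s => // A s IH _ As.
have FA : F A by apply: As; left.
have [->|s0] := pselect (s = [::]).
  by exists A => // B [<-|[]].
have [//|B Bs|B FB Bmax] := IH; first by apply: As; right.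
have [AB|BA] := Ftot A B FA FB.
  by exists B => // C [<-//|]; exact: Bmax.
by exists A => // C [<-//|/Bmax CB]; exact: subset_trans CB BA.
Qed.

(** A finite part of the chain has a largest member [A], so only one set [E A] has to be met. This
    gives the chain condition for Zorn's lemma and the limit steps of the tree. *)
Lemma compact_chain (X : topologicalType) (T : Type) (F : set (set T))
    (E : set T -> set X) (D : set X) :
    compact [set: X] -> total_on F subset -> closed D -> D !=set0 ->
    (forall A, F A -> closed (E A)) ->
    (forall A B, A `<=` B -> E B `<=` E A) ->
    (forall A, F A -> (D `&` E A) !=set0) ->
  exists2 x, D x & forall A, F A -> E A x.
Proof.
move=> cX Ftot clD D0 clE Eanti E0.
pose C A := [set x | D x /\ (F A -> E A x)].
have [||x Cx] := @compact_fip X _ C cX.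
- move=> A; have [FA|nFA] := pselect (F A).
    rewrite (_ : C A = D `&` E A); first by apply: closedI => //; exact: clE.
    apply/seteqP; split=> [x [Dx /(_ FA)]|x [Dx Ex]]; first by split.
    by split.
  rewrite (_ : C A = D) //; apply/seteqP; split=> [x []//|x Dx].
  by split.
- move=> r; pose r' := List.filter (fun A => `[< F A >]) r.
  have r'P A : List.In A r' <-> List.In A r /\ F A.
    by rewrite List.filter_In; split=> -[Ar FA]; split=> //; exact/asboolP.
  have [r0|r0] := pselect (r' = [::]).
    have [x Dx] := D0; exists x => A Ar; split=> // FA.
    have : List.In A r' by apply/r'P.
    by rewrite r0.
  have [A FA Amax] := chain_list_max Ftot r0 (fun A h => (proj1 (r'P A) h).2).
  have [x [Dx Ex]] := E0 A FA; exists x => B Br; split=> // FB.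
  by apply: Eanti Ex; apply: Amax; exact/r'P.
by exists x; [exact: (Cx set0).1|move=> A; exact: (Cx A).2].
Qed.

(* A maximal open set V such that every finite pattern is attained outside V:
   its complement Z is irreducible over 2^J, so a neighbourhood base at a point
   of Z must decide every coordinate j in J. *)
Lemma independent_tle (K J : Type) (X : topologicalType)
    (C : bool -> J -> set X) :
    compact [set: X] -> hausdorff_space X -> tle nat K -> tle (K * K) K ->
    (forall Z : set X, closed Z -> Z !=set0 -> exists z, Gpoint K Z z) ->
    (forall b j, closed (C b j)) ->
    (forall j x, C true j x -> C false j x -> False) ->
    (forall s t, exists x, capl (fun j => C (t j) j) s x) ->
  tle J K.
Proof.
move=> cX hX natK KK HK clC disC indC.
pose P (V : set X) := open V /\ forall s t, exists2 x,
  ~ V x & capl (fun j => C (t j) j) s x.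
have [|V [[oV VP] Vmax]] := @Zorn_bigcup _ P.
  move=> F FP Ftot; split=> [|s t].
    by apply: bigcup_open => V FV; have [] := FP V FV.
  pose D := capl (fun j => C (t j) j) s.
  have clD : closed D.
    rewrite (_ : D = \bigcap_(j in [set j | List.In j s]) C (t j) j) //.
    by apply: closed_bigI => j _; exact: clC.
  have [|||x Dx Fx] := @compact_chain X X F setC D cX Ftot clD (indC s t).
  - by move=> V /FP[oV _]; exact: open_closedC.
  - by move=> A B AB; exact: subsetC.
  - by move=> V /FP[_ /(_ s t)[x nVx Dx]]; exists x.
  by exists x => // -[V FV Vx]; exact: (Fx V FV Vx).
have [x0 nVx0 _] := VP [::] (fun=> true).
have clZ : closed (~` V) by exact: open_closedC.
have [z Gz] := HK _ clZ (ex_intro _ x0 nVx0).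
have [N [Nz _ Nbase]] := Gpoint_base cX hX clZ Gz.
have nVz : ~ V z by have [] := Gz.
(* By maximality, adjoining [N s] to [V] destroys a finite pattern: the points outside [V] that
   realize it all lie in [N s]. *)
have /choice[r rP] s : exists r : seq J, exists t, forall x, ~ V x ->
    capl (fun j => C (t j) j) r x -> N s x.
  apply: contrapT => nr; apply: (Vmax (V `|` N s)).
    split; first by left.
    by move=> /(_ z (or_intror (Nz s).2)).
  split=> [|r t]; first by apply: openU => //; exact: (Nz s).1.
  apply: contrapT => nx; apply: nr; exists r, t => x Vx Cx.
  by apply: contrapT => nNx; apply: nx; exists x => // -[].
(* Otherwise the pattern on [r s] can be extended at [j] by a side [b] that [N s] avoids outside
   [V], although the extended pattern is realized there. *)
have cover j : exists s, List.In j (r s).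
  apply: contrapT => nj.
  have [b nCb] : exists b, ~ C b j z.
    have [Ct|nCt] := pselect (C true j z); last by exists true.
    by exists false => Cf; exact: (disC j z).
  have [s sO] := Nbase (~` C b j) (closed_openC (clC b j)) nCb.
  have [t tP] := rP s.
  pose t' i := if pselect (i = j) then b else t i.
  have [x Vx xP] := VP (j :: r s) t'.
  have Cjx : C b j x.
    have := xP j (or_introl erefl); rewrite /t'.
    by case: pselect.
  apply: (sO x) => //; split=> //; apply: tP => // i ir.
  have := xP i (or_intror ir); rewrite /t'.
  by case: pselect => // ij; case: nj; exists s; rewrite -ij.
have /choice[f fP] j : exists p : seq K * nat,
    List.nth_error (r p.1) p.2 = Some j.
  have [s /(@List.In_nth_error _ _ _)[n jn]] := cover j.
  by exists (s, n).
apply: tle_trans (tle_trans (tle_prod (seq_tle natK KK) natK) KK).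
by exists f => i j ij; have := fP i; rewrite ij fP => -[].
Qed.

(** * Characters in power homogeneous compacta *)

(** The filter of agreement with [x] on finitely many coordinates converges to [x] in each
    coordinate, hence in the product. *)
Lemma prod_open_finite (I : Type) (X : topologicalType)
    (O : set (prod_topology (fun _ : I => X))) (x : prod_topology (fun _ : I => X)) :
    open O -> O x ->
  exists s : seq I, forall y : prod_topology (fun _ : I => X),
    (forall i, List.In i s -> y i = x i) -> O y.
Proof.
move=> oO Ox.
pose F := filter_from [set: seq I] (fun s => [set y : prod_topology (fun _ : I => X) |
  forall i, List.In i s -> y i = x i]).
have FF : Filter F.
  apply: filter_from_filter; first by exists [::].
  move=> s t _ _; exists (s ++ t) => // y h.
  by split=> i is_; apply: h; apply/List.in_app_iff; [left|right].
have Fx : F --> x.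
  apply/cvg_sup => i A; rewrite nbhsE => -[_ [[B oB <-] Bx] BA].
  exists [:: i] => // y yx; apply: BA.
  by rewrite /preimage /= yx //; left.
by have [s _ sO] := Fx O (open_nbhs_nbhs (conj oO Ox)); exists s.
Qed.

(* A patch which is good for R witnesses, through finitely many coordinates
   outside R, that f is not constant on the points equal to p on R. *)
Record patch (I X : Type) := Patch {
  patch_supp : seq I; patch_pt : I -> X; patch_in : set X; patch_out : set X }.

Section Determination.

Variables (K I : Type) (X : topologicalType) (f : (I -> X) -> X) (p : X).

Definition patch_good (R : set I) (d : patch I X) : Prop :=
  [/\ closed (patch_in d), closed (patch_out d),
      patch_in d `&` patch_out d = set0,
      forall i, List.In i (patch_supp d) -> ~ R i &
      forall y, (forall i, R i -> y i = p) ->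
        ((forall i, List.In i (patch_supp d) -> y i = p) -> patch_in d (f y)) /\
        ((forall i, List.In i (patch_supp d) -> y i = patch_pt d i) ->
          patch_out d (f y))].

Definition patch_disjoint (d d' : patch I X) : Prop :=
  forall i, List.In i (patch_supp d) -> List.In i (patch_supp d') -> False.

Lemma maximal_patches (R : set I) : exists M : set (patch I X),
  [/\ forall d, M d -> patch_good R d,
      forall d d', M d -> M d' -> d = d' \/ patch_disjoint d d' &
      forall d, patch_good R d -> (forall d', M d' -> patch_disjoint d d') -> M d].
Proof.
pose P (M : set (patch I X)) := (forall d, M d -> patch_good R d) /\
  (forall d d', M d -> M d' -> d = d' \/ patch_disjoint d d').
have [|M [[Mgood Mdis] Mmax]] := @Zorn_bigcup _ P.
  move=> F FP Ftot; split=> [d [M FM Md]|d d' [M FM Md] [N FN Nd]].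
    exact: (FP M FM).1.
  by have [MN|NM] := Ftot _ _ FM FN;
    [apply: (FP N FN).2 => //; exact: MN|apply: (FP M FM).2 => //; exact: NM].
exists M; split=> // d dg dM; apply: contrapT => nMd.
apply: (Mmax (M `|` [set d])).
  by split; [left|move=> sub; apply: nMd; apply: sub; right].
split=> [e [/Mgood//|->//]|e e' [Me|->] [Me'|->]].
- exact: Mdis.
- by right=> i ie id; exact: (dM e Me i).
- by right; exact: dM.
- by left.
Qed.

Hypotheses (cX : compact [set: X]) (hX : hausdorff_space X).
Hypotheses (natK : tle nat K) (KK : tle (K * K) K).
Hypothesis HK :
  forall Z : set X, closed Z -> Z !=set0 -> exists z, Gpoint K Z z.

(** As the supports are disjoint, one point [y] can follow either [p] or [patch_pt] on each patch
    separately, so [f y] realizes any prescribed pattern. The pairs [patch_in], [patch_out] are thus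
    independent, and [independent_tle] applies. *)
Lemma patches_tle (R : set I) (M : set (patch I X)) :
    (forall d, M d -> patch_good R d) ->
    (forall d d', M d -> M d' -> d = d' \/ patch_disjoint d d') ->
  tle {d | M d} K.
Proof.
move=> Mgood Mdis.
pose C b (d : {d | M d}) := if b then patch_out (sval d) else patch_in (sval d).
apply: (@independent_tle K _ X C) => //.
- by move=> b [d Md]; have [? ? _ _ _] := Mgood d Md; case: b.
- move=> [d Md] x xo xi; have [_ _ dis _ _] := Mgood d Md.
  have : (patch_in d `&` patch_out d) x by [].
  by rewrite dis.
move=> s t.
have /choice[y yP] i : exists v, (forall d : {d | M d},
      List.In i (patch_supp (sval d)) ->
      v = if t d then patch_pt (sval d) i else p) /\
    ((forall d : {d | M d}, ~ List.In i (patch_supp (sval d))) -> v = p).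
  have [[d id]|nd] := pselect (exists d : {d | M d}, List.In i (patch_supp (sval d))).
    exists (if t d then patch_pt (sval d) i else p); split=> [e ie|/(_ d)//].
    have [/sval_inj -> //|dis] := Mdis _ _ (svalP d) (svalP e).
    by case: (dis i).
  by exists p; split=> [d id|//]; case: nd; exists d.
exists (f y) => -[d Md] _; have [_ _ _ dR dP] := Mgood d Md.
have [|yin yout] := dP y.
  move=> i Ri; apply: (yP i).2 => -[e Me] ie.
  by have [_ _ _ /(_ i ie) h _] := Mgood e Me; exact: h.
case td: (t (exist _ d Md)) => /=.
  by apply: yout => i id; rewrite ((yP i).1 (exist _ d Md) id) td.
by apply: yin => i id; rewrite ((yP i).1 (exist _ d Md) id) td.
Qed.

Lemma enum_supports (i0 : I) (M : set (patch I X)) : tle {d | M d} K ->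
  exists e : K -> I, forall d i, M d -> List.In i (patch_supp d) ->
    exists k, e k = i.
Proof.
move=> MK; have [[d0 Md0]|M0] := pselect (M !=set0); last first.
  by exists (fun=> i0) => d i Md; case: M0; exists d.
have [k0 _] := natK.
have [g gP] := tle_enum (exist _ d0 Md0) MK.
have [h hP] := tle_enum (k0 0, 0) (tle_trans (tle_prod (tle_refl K) natK) KK).
exists (fun k => List.nth (h k).2 (patch_supp (sval (g (h k).1))) i0) => d i Md id.
have [n [_ ni]] := List.In_nth _ _ i0 id.
have [k gk] := gP (exist _ d Md); have [l hl] := hP (k, n).
by exists l; rewrite hl /= gk.
Qed.

(* If x|A = p never decided f x, the maximal families M_R over the finite
   subsets R of a set A of size |K| closed under R |-> supports of M_R could
   be extended by a patch living outside A. *)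
Lemma determined :
    continuous (f : prod_topology (fun _ : I => X) -> X) -> inhabited I ->
  exists a : K -> I, forall x, (forall k, x (a k) = p) -> f x = f (fun=> p).
Proof.
move=> fC [i0]; apply: contrapT => na.
have [M MP] := choice maximal_patches.
have /choice[e eP] (R : set I) : exists e : K -> I, forall d i, M R d ->
    List.In i (patch_supp d) -> exists k, e k = i.
  apply: enum_supports => //; have [? ? _] := MP R.
  exact: (patches_tle (R := R)).
have [k0 k0I] := natK.
have natseq : tle (seq K) K by exact: seq_tle.
have [dec decP] : exists dec : K -> K + seq K * K, forall u, exists k, dec k = u.
  apply: tle_enum (inl (k0 0)) (sum_tle natK KK (tle_refl K) _).
  exact: tle_trans (tle_prod natseq (tle_refl K)) KK.
(* Stage [n.+1] keeps stage [n] and, for each finite [R] listed from it, adds the range of [e R],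
   which contains the supports of [M R]. *)
pose a := fix a n : K -> I := if n is n.+1 then fun k =>
  match dec k with
  | inl l => a n l
  | inr q => e [set i | List.In i (map (a n) q.1)] q.2
  end else fun=> i0.
pose A i := exists n k, a n k = i.
have aS n k : exists l, a n.+1 l = a n k.
  by have [l lk] := decP (inl k); exists l; rewrite /= lk.
have aD n d k : exists l, a (d + n) l = a n k.
  elim: d => [|d [l <-]]; first by exists k.
  exact: aS.
have aE n s k : A (e [set i | List.In i (map (a n) s)] k).
  by have [l lk] := decP (inr (s, k)); exists n.+1, l; rewrite /= lk.
have Alist l : (forall i, List.In i l -> A i) -> exists n s, map (a n) s = l.
  elim: l => [|i l IH] Al; first by exists 0, [::].
  have [|n [s sl]] := IH; first by move=> j jl; apply: Al; right.
  have [m [k ki]] : A i by apply: Al; left.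
  exists (m + n).
  have [k' k'E] := aD m n k; rewrite addnC in k'E.
  have [t tE] : exists t, map (a (m + n)) t = map (a n) s.
    elim: {sl} s => [|x s [t tE]]; first by exists [::].
    by have [x' x'E] := aD n m x; exists (x' :: t); rewrite /= x'E tE.
  by exists (k' :: t); rewrite /= k'E ki tE sl.
have [b bP] : exists b : K -> I, forall i, A i -> exists k, b k = i.
  have [g gP] := tle_enum (0, k0 0) (tle_trans (tle_prod natK (tle_refl K)) KK).
  exists (fun k => a (g k).1 (g k).2) => i [n [k <-]].
  by have [l lE] := gP (n, k); exists l; rewrite lE.
have [x xA xq] : exists2 x, forall i, A i -> x i = p & f x <> f (fun=> p).
  apply: contrapT => nx; apply: na.
  exists b => x xb; apply: contrapT => fx; apply: nx; exists x => // i /bP[k <-].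
  exact: xb.
have [U [V [oU oV Uq Vx UV]]] := separate_points cX hX (nesym xq).
have pre (O : set X) : open O -> open (f @^-1` O : set (prod_topology (fun _ : I => X))).
  by move=> oO; move/continuousP: fC; exact.
have [T0 T0P] := prod_open_finite (pre U oU) (Uq : (f @^-1` U) (fun=> p)).
have [T1 T1P] := prod_open_finite (pre V oV) (Vx : (f @^-1` V) x).
pose T := T0 ++ T1.
have [n [s sE]] : exists n s, map (a n) s = List.filter (fun i => `[< A i >]) T.
  by apply: Alist => i; rewrite List.filter_In => -[_ /asboolP].
pose R := [set i | List.In i (map (a n) s)].
have RP i : R i <-> List.In i T /\ A i.
  rewrite /R /= sE List.filter_In; split=> -[iT Ai]; split=> //; exact/asboolP.
pose S := List.filter (fun i => ~~ `[< A i >]) T.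
have SP i : List.In i S <-> List.In i T /\ ~ A i.
  by rewrite /S List.filter_In; split=> -[iT Ai]; split=> //; exact/asboolPn.
(* The finite set [R] is the part of [T] in [A], and [d] is supported on the rest. It is disjoint
   from the patches of [M R], whose supports lie in [A], so maximality puts [d] in [M R]. Its own
   support then lies in [A], hence is empty, and the constant point is sent into both closures. *)
pose d := Patch S x (closure U) (closure V).
have split_T (y z : I -> X) : (forall i, A i -> z i = p) -> (forall i, R i -> y i = p) ->
    (forall i, List.In i S -> y i = z i) -> forall i, List.In i T -> y i = z i.
  move=> zA yR yS i iT; have [Ai|nAi] := pselect (A i).
    by rewrite yR ?zA//; apply/RP.
  by apply: yS; apply/SP.
have dgood : patch_good R d.
  split=> //=.
  - exact: closed_closure.
  - exact: closed_closure.
  - by move=> i /SP[_ nAi] /RP[].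
  - move=> y yR; split=> yS; apply: subset_closure.
      apply: T0P => i iT; apply: (split_T y (fun=> p)) => //.
      by apply/List.in_app_iff; left.
    apply: T1P => i iT; apply: (split_T y x) => //.
    by apply/List.in_app_iff; right.
have [_ _ Rmax] := MP R.
have Md : M R d.
  apply: Rmax => // d' Md' i /SP[_ nAi] id'.
  by have [k ki] := eP R d' i Md' id'; apply: nAi; rewrite -ki; exact: aE.
have S0 i : ~ List.In i S.
  move=> iS; have [_ nAi] := (SP i).1 iS.
  by have [k ki] := eP R d i Md iS; apply: nAi; rewrite -ki; exact: aE.
have [_ _ _ _ /(_ (fun=> p) (fun _ _ => erefl))[din dout]] := dgood.
have : (closure U `&` closure V) (f (fun=> p)).
  by split; [apply: din|apply: dout] => i /S0.
by rewrite UV.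
Qed.

End Determination.

(** A homeomorphism [h] with inverse [g] takes the constant point at [p], of small character, to the
    one at [q]. By [determined], [h y i0] is [q] once [y] equals [p] on all coordinates [a k]. With
    [j] embedding [X] as the [i0]-axis through [q], the neighbourhoods of [p] are pulled back along
    these coordinates of [g \o j]; only [q] lies in all of the resulting open sets. *)
Lemma power_homogeneous_Gpoint (K : Type) (X : topologicalType) :
    compact [set: X] -> hausdorff_space X -> tle nat K -> tle (K * K) K ->
    (forall Z : set X, closed Z -> Z !=set0 -> exists z, Gpoint K Z z) ->
    power_homogeneous X ->
  forall q : X, Gpoint K [set: X] q.
Proof.
move=> cX hX natK KK HK [I [[i0] hom]] q.
have [p [_ [U [oU Up]]]] := HK setT closedT (ex_intro _ q Logic.I).
pose Y := prod_topology (fun _ : I => X).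
have [h [hC [g [gC hK gK]]] hp] := hom (fun=> p) (fun=> q).
have prC i : continuous (fun y : Y => y i).
  exact: (@proj_continuous {classic I} (fun=> X) i).
pose j : X -> Y := @dfwith {classic I} (fun=> X) (fun=> q) i0.
have jC : continuous j by exact: (@dfwith_continuous {classic I} (fun=> X)).
have jE x : j x i0 = x by exact: (@dfwithin {classic I}).
have jq : j q = fun=> q.
  apply/funext => i; have [->|/eqP ne] := pselect (i = i0 :> {classic I}).
    exact: jE.
  by rewrite /j dfwithout // eq_sym.
have fC : continuous (fun y : Y => h y i0).
  by move=> y; apply: (@continuous_comp _ _ _ h (fun z : Y => z i0)); [exact: hC|exact: prC].
have [a aP] := determined p cX hX natK KK HK fC (inhabits i0).
have hgq : g (fun=> q) = fun=> p by rewrite -hp hK.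
have [k0 _] := natK.
have [dec decP] := tle_enum (k0 0, k0 0) KK.
split=> //; exists (fun k x => U (dec k).2 (g (j x) (a (dec k).1))); split.
  move=> k; split; last by rewrite jq hgq; exact: (oU _).2.
  have gjC : continuous (fun x => g (j x) (a (dec k).1)).
    move=> x; apply: (@continuous_comp _ _ _ (g \o j)
      (fun z : Y => z (a (dec k).1))); last exact: prC.
    by apply: (@continuous_comp _ _ _ j g); [exact: jC|exact: gC].
  by move/continuousP : gjC => /(_ _ (oU (dec k).2).1).
move=> x _ xU; have gp k : g (j x) (a k) = p.
  apply: (Up _ Logic.I) => l; have [m mE] := decP (k, l).
  by have := xU m; rewrite mE.
by have := aP _ gp; rewrite gK hp jE.
Qed.

(** * The bound on the cardinality, and covers by discrete sets *)

Inductive ktree (K L : Type) : Type :=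
  | KLeaf
  | KNode of L & (K -> ktree K L).
Arguments KLeaf {K L}.

Fixpoint ktree_label (K L : Type) (t : ktree K L) (s : seq K) : option L :=
  match t, s with
  | KLeaf, _ => None
  | KNode l c, [::] => Some l
  | KNode l c, k :: s => ktree_label (c k) s
  end.

Lemma ktree_label_inj (K L : Type) : injective (@ktree_label K L).
Proof.
elim=> [|l c IH] [|m d] E //; first by have := congr1 (@^~ [::]) E.
  by have := congr1 (@^~ [::]) E.
have [->] := congr1 (@^~ [::]) E; congr (KNode m _); apply/funext => k.
by apply: IH; apply/funext => s; exact: (congr1 (@^~ (k :: s)) E).
Qed.

(** A tree is determined by the labels at its addresses, hence by a subset of [seq K * L]. *)
Lemma ktree_tle (K L : Type) :
  tle nat K -> tle (K * K) K -> tle L K -> tle (ktree K L) (set K).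
Proof.
move=> natK KK LK.
apply: tle_trans (tle_set (tle_trans (tle_prod (seq_tle natK KK) LK) KK)).
exists (fun t => [set p | ktree_label t p.1 = Some p.2]) => t u E.
apply: ktree_label_inj; apply/funext => s.
have {}E l : ktree_label t s = Some l <-> ktree_label u s = Some l.
  have := congr1 (fun A : set (seq K * L) => A (s, l)) E.
  by rewrite /= => ->.
case: (ktree_label t s) E => [l|] E; first by apply/esym/E.
by case: (ktree_label u s) E => [l|//] /(_ l)[_ /(_ erefl)].
Qed.

(* Arhangel'skii's closing-off argument.  K-branching well-founded trees denote
   points of X: a node is either the limit of a net of its children or a point
   missed by finitely many basic neighbourhoods of its children.  The set of
   denoted points is compact, hence everything. *)
Lemma Gpoint_tle (K : Type) (X : topologicalType) :
    compact [set: X] -> hausdorff_space X -> tle nat K -> tle (K * K) K ->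
    (forall q : X, Gpoint K [set: X] q) ->
  tle X (set K).
Proof.
move=> cX hX natK KK GX.
have [[x0]|noX] := pselect (inhabited X); last first.
  by exists (fun=> set0) => x; case: noX.
have seqK : tle (seq K) K by exact: seq_tle.
have /choice[N NP] x := Gpoint_base cX hX closedT (GX x).
(* The label [inl tt] asks for a limit of the children; [inr l] asks for a point outside [N y s] for
   each [(k, s)] in [l], with [y] the child [k]. *)
pose L := (unit + seq (K * seq K))%type.
have LK : tle L K.
  apply: sum_tle => //; first by have [k0 _] := natK; exists (fun=> k0 0) => -[] [].
  exact: tle_trans (tle_seq (tle_trans (tle_prod (tle_refl K) seqK) KK)) seqK.
pose conv (y : seq K -> X) z := forall O, open O -> O z ->
  exists s0, forall s, (forall k, List.In k s0 -> List.In k s) -> O (y s).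
have convU y z z' : conv y z -> conv y z' -> z = z'.
  move=> yz yz'; apply: contrapT => zz'.
  have [U [V [oU oV Uz Vz' UV]]] := separate_points cX hX zz'.
  have [s sU] := yz U oU Uz; have [t tV] := yz' V oV Vz'.
  have : (closure U `&` closure V) (y (s ++ t)).
    by split; apply: subset_closure; [apply: sU|apply: tV] => k ks;
      apply/List.in_app_iff; [left|right].
  by rewrite UV.
have /choice[lim limP] y : exists x, forall z, conv y z -> x = z.
  have [[x yx]|ny] := pselect (exists x, conv y x); last first.
    by exists x0 => z yz; case: ny; exists z.
  by exists x => z; exact: convU.
pose miss (ly : seq (K * seq K) * (K -> X)) x := forall p, List.In p ly.1 ->
  ~ N (ly.2 p.1) p.2 x.
have /choice[pick pickP] ly : exists x, (exists z, miss ly z) -> miss ly x.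
  have [[x lx]|nl] := pselect (exists x, miss ly x); first by exists x.
  by exists x0.
(* [r] is a section of the enumeration [d] of lists, so the children of a node form a net indexed by
   lists. *)
have [d dS] := tle_enum [::] seqK.
have [r rK] := choice dS.
pose eval := fix eval (t : ktree K L) : X :=
  match t with
  | KLeaf => x0
  | KNode (inl _) c => lim (fun s => eval (c (r s)))
  | KNode (inr l) c => pick (l, fun k => eval (c k))
  end.
suff evalS x : exists t, eval t = x.
  exact: tle_trans (tle_surj evalS) (ktree_tle natK KK LK).
pose H := range eval.
have clH : closed H.
  move=> z Hz.
  have /choice[T TP] s : exists t, N z s (eval t).
    have [/(_ s)[oN Nz] _ _] := NP z.
    have [_ [[t _ <-] Nt]] := Hz _ (open_nbhs_nbhs (conj oN Nz)).
    by exists t.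
  exists (KNode (inl tt) (fun k => T (d k))) => //; apply: limP => O oO Oz.
  have [_ mono base] := NP z.
  have [s0 s0O] := base O oO Oz; exists s0 => s s0s; apply: s0O; split=> //.
  by rewrite rK; apply: (mono _ _ s0s); exact: TP.
(* If [x] has no name, every named point has a basic neighbourhood missing [x]. Finitely many of
   these would cover the compact set [H]; but [x] escapes them, so a node picking such a point names
   a member of [H] outside them. *)
apply: contrapT => nx.
have /choice[g gP] t : exists s, ~ N (eval t) s x.
  have [_ _ base] := NP (eval t).
  have [||s sx] := base (~` [set x]); first by apply: closed_openC; exact: closed1.
    by move=> tx; apply: nx; exists t.
  by exists s => Nx; exact: (sx x).
pose C (o : option (ktree K L)) := if o is Some t then ~` N (eval t) (g t) else H.
apply: contrapT => _.
have [||h hC] := @compact_fip X _ C cX; last 1 first.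
- have [t _ th] := hC None; apply: (hC (Some t)); rewrite th.
  by have [/(_ (g t))[]] := NP h.
- move=> [t|] //=; apply: open_closedC.
  by have [/(_ (g t))[]] := NP (eval t).
move=> s; pose ts := pmap id s.
have [e eS] := tle_enum 0 natK.
pose c k := List.nth (e k) ts KLeaf.
have /choice[ix ixP] t : exists k, List.In t ts -> c k = t.
  have [tts|] := pselect (List.In t ts); last first.
    by have [k0 _] := natK; exists (k0 0).
  have [n [_ nt]] := List.In_nth _ _ KLeaf tts.
  by have [k ke] := eS n; exists k => _; rewrite /c ke.
pose l := map (fun t => (ix t, g t)) ts.
exists (eval (KNode (inr l) c)) => -[t|] /=; last first.
  by move=> _; exists (KNode (inr l) c).
move=> ts_; have tts : List.In t ts by exact: In_pmap_id.
have missx : exists z, miss (l, fun k => eval (c k)) z.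
  by exists x => _ /(List.in_map_iff _ _ _)[u [<- uts]] /=; rewrite ixP.
have := pickP _ missx (ix t, g t); rewrite /= ixP //; apply.
by apply/List.in_map_iff; exists t.
Qed.

(** * Covers by discrete sets *)

Lemma discrete_closure (X : topologicalType) (D : set X) x :
    hausdorff_space X -> discrete_subset D -> D x ->
  exists U, [/\ open U, U x & forall y, U y -> closure D y -> y = x].
Proof.
move=> hX /discrete_subsetP dD Dx; have [U oU UD] := dD x Dx.
exists U; split=> //; first by have [] : (U `&` D) x by rewrite UD.
move=> y Uy Dy; apply: contrapT => yx.
have oV : open (U `&` ~` [set x]) by apply: openI => //; apply: closed_openC; exact: closed1.
have [z [Dz [Uz zx]]] := Dy _ (open_nbhs_nbhs (conj oV (conj Uy yx))).
by apply: zx; rewrite -UD.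
Qed.

(* Gruenhage: take a maximal set S of indices such that the closures of the D_j,
   j in S, meet the given closed set; every point of the intersection is
   isolated in one of these closures, so the intersection is finite and is
   determined by finitely many of the sets involved. *)
Lemma discrete_cover_trace (X : topologicalType) (J T : Type) (D : J -> set X)
    (F : T -> set X) (P : set T) :
    compact [set: X] -> hausdorff_space X ->
    (forall j, discrete_subset (D j)) -> (forall x, exists j, D j x) ->
    (forall i, closed (F i)) -> (exists x, forall i, P i -> F i x) ->
  exists s : seq J * seq T, (exists x, capl (closure \o D) s.1 x /\ capl F s.2 x) /\
    forall x, capl (closure \o D) s.1 x -> capl F s.2 x -> forall i, P i -> F i x.
Proof.
move=> cX hX dD covD clF FP0.
pose PF := [set x | forall i, P i -> F i x].
pose E (S : set J) := [set x | forall j, S j -> closure (D j) x].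
have clPF : closed PF.
  by rewrite (_ : PF = \bigcap_(i in P) F i) //; apply: closed_bigI => i _.
have clE S : closed (E S).
  rewrite (_ : E S = \bigcap_(j in S) closure (D j)) //.
  by apply: closed_bigI => j _; exact: closed_closure.
have [|S [[x0 [PFx0 Ex0]] Smax]] := @Zorn_bigcup _ (fun S => (PF `&` E S) !=set0).
  move=> G GP Gtot.
  have [|x PFx Ex] := compact_chain cX Gtot clPF FP0 (fun A _ => clE A) _ GP.
    by move=> A B AB x xB j /AB; exact: xB.
  by exists x; split=> // j [A GA Aj]; exact: Ex Aj.
pose M := PF `&` E S.
(* By maximality of [S], a set [D j] containing a point [x] of [M] has [j] in [S]; the open set
   isolates [x] in its closure. *)
have /choice[w wP] (x : X) : exists p : J * set X, M x -> [/\ S p.1, open p.2, p.2 x &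
    forall y, p.2 y -> closure (D p.1) y -> y = x].
  have [j Dj] := covD x; have [U [oU Ux Uc]] := discrete_closure hX (dD j) Dj.
  exists (j, U) => -[PFx ESx]; split=> //=; apply: contrapT => nSj.
  apply: (Smax (S `|` [set j])).
    by split; [left|move=> sub; apply: nSj; apply: sub; right].
  exists x; split=> // i [|->]; first exact: ESx.
  exact: subset_closure.
pose C (u : {i | P i} + ({j | S j} + {x | M x})) := match u with
  | inl i => F (sval i) | inr (inl j) => closure (D (sval j))
  | inr (inr x) => ~` (w (sval x)).2 end.
(* The isolating neighbourhoods cover [M], so finitely many of them cover a finite intersection of
   the closed sets defining [M]. Listing also the closures in which they isolate their points
   confines the trace to [M]. *)
have [u uE] : exists u, ~ (capl C u !=set0).
  apply/existsNP => finC.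
  have [|y yC] := @compact_fip X _ C cX _ finC.
    move=> [i|[j|[x Mx]]] /=; [exact: clF|exact: closed_closure|].
    by apply: open_closedC; have [] := wP x Mx.
  have My : M y.
    split=> [i Pi|j Sj]; first exact: (yC (inl (exist _ i Pi))).
    exact: (yC (inr (inl (exist _ j Sj)))).
  by have [_ _ wy _] := wP y My; apply: (yC (inr (inr (exist _ y My)))).
pose s := List.flat_map (fun v => match v with
  | inr (inl j) => [:: sval j] | inr (inr x) => [:: (w (sval x)).1] | _ => [::] end) u.
pose t := List.flat_map (fun v => match v with
  | inl i => [:: sval i] | _ => [::] end) u.
exists (s, t); split=> [|y ys yt].
  exists x0; split=> [j /(List.in_flat_map _ _ _)[[i|[[i Si]|[x Mx]]] [vu]]|i] //=.
  - by case=> // <-; exact: Ex0.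
  - by case=> // <-; apply: Ex0; have [] := wP x Mx.
  move=> /(List.in_flat_map _ _ _)[[[k Pk]|[j|x]] [vu]] //= [] // <-.
  exact: PFx0.
suff : M y by case.
apply: contrapT => nMy; apply: uE; exists y => -[i|[j|[x Mx]]] vu /=.
- by apply: yt; apply/List.in_flat_map; exists (inl i); split=> //; left.
- by apply: ys; apply/List.in_flat_map; exists (inr (inl j)); split=> //; left.
- move=> wy; have [_ _ _ wE] := wP x Mx; apply: nMy; rewrite (wE y wy) //.
  apply: ys; apply/List.in_flat_map; exists (inr (inr (exist _ x Mx))).
  by split=> //; left.
Qed.

(** A Baire category argument: without isolated points, any nonempty open set contains the closure
    of a nonempty open set missing [D n]. A point in all the successive closures escapes every
    [D n]. *)
Lemma uncountable_dis (X : topologicalType) (D : nat -> set X) :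
    compact [set: X] -> hausdorff_space X -> [set: X] !=set0 ->
    (forall x : X, ~ open [set x]) -> (forall n, discrete_subset (D n)) ->
  exists x, forall n, ~ D n x.
Proof.
move=> cX hX X0 crowded dD.
have step n (V : set X) : exists V', open V -> V !=set0 ->
    [/\ open V', V' !=set0, closure V' `<=` V & V' `&` D n = set0].
  have [[oV [x Vx]]|nV] := pselect (open V /\ V !=set0); last first.
    by exists set0 => oV V0; case: nV.
  have [B [oB [y By] BV BD]] : exists B, [/\ open B, B !=set0, B `<=` V & B `&` D n = set0].
    have [[d [Vd Dd]]|VD] := pselect ((V `&` D n) !=set0); last first.
      exists V; split=> //; first by exists x.
      by apply/seteqP; split=> // z zVD; apply: VD; exists z.
    have [U oU UD] := (discrete_subsetP _).1 (dD n) d Dd.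
    exists (V `&` U `&` ~` [set d]); split.
    - by apply: openI; [exact: openI|apply: closed_openC; exact: closed1].
    - apply: contrapT => B0; apply: (crowded d).
      rewrite (_ : [set d] = V `&` U); first exact: openI.
      apply/seteqP; split=> [_ ->|z VUz].
        by split=> //; have [] : (U `&` D n) d by rewrite UD.
      by apply: contrapT => zd; apply: B0; exists z.
    - by move=> z [[]].
    - apply/seteqP; split=> // z [[[_ Uz] zd] Dz].
      by apply: zd; rewrite -UD.
  have [V' [oV' V'y V'B]] := open_shrink cX hX oB By.
  exists V' => _ _; split=> //; first by exists y.
    exact: subset_trans V'B BV.
  apply/seteqP; split=> // z [V'z Dz]; rewrite -BD; split=> //.
  by apply: V'B; exact: subset_closure.
have /choice[sh shP] : forall p : nat * set X, exists V', open p.2 -> p.2 !=set0 ->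
    [/\ open V', V' !=set0, closure V' `<=` p.2 & V' `&` D p.1 = set0].
  by move=> [n V]; exact: step.
pose V := fix V n := if n is n.+1 then sh (n, V n) else setT.
have oV n : open (V n) /\ V n !=set0.
  elim: n => [|n [oV V0]]; first by split=> //; exact: openT.
  by have [] := shP (n, V n) oV V0.
have VS n : closure (V n.+1) `<=` V n.
  by have [] := shP (n, V n) (oV n).1 (oV n).2.
have Vdec n m : V (m + n) `<=` V n.
  by elim: m => // m IH z /subset_closure /VS; exact: IH.
have [|s|x xV] := @compact_fip X _ (fun n => closure (V n)) cX.
- by move=> n; exact: closed_closure.
- have [m ms] : exists m, forall n, List.In n s -> n <= m.
    elim: s => [|n s [m ms]]; first by exists 0.
    exists (maxn n m) => k [<-|/ms]; first exact: leq_maxl.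
    by move=> /leq_trans; apply; exact: leq_maxr.
  have [x Vx] := (oV m).2; exists x => n /ms nm; apply: subset_closure.
  by apply: (Vdec n (m - n)); rewrite subnK.
exists x => n Dx; have [_ _ _] := shP (n, V n) (oV n).1 (oV n).2.
move=> E; have : (sh (n, V n) `&` D (n, V n).1) x by split=> //; exact: (VS n.+1 _ (xV n.+2)).
by rewrite E.
Qed.

(** * The tree of closed sets *)

(** With each [closure (V n.+1)] inside [V n], the intersection equals that of the closures. *)
Lemma closed_gdelta_nbhs (X : topologicalType) (x : X) (O : set X) :
    compact [set: X] -> hausdorff_space X -> open O -> O x ->
  exists V : nat -> set X, [/\ forall n, open (V n) /\ V n x,
    \bigcap_n V n `<=` O & closed (\bigcap_n V n)].
Proof.
move=> cX hX oO Ox.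
have /choice[sh shP] (A : set X) : exists V, open A -> A x ->
    [/\ open V, V x & closure V `<=` A].
  have [[oA Ax]|nA] := pselect (open A /\ A x); last first.
    by exists A => oA Ax; case: nA.
  by have [V ?] := open_shrink cX hX oA Ax; exists V.
pose V := fix V n := if n is n.+1 then sh (V n) else O.
have oV n : open (V n) /\ V n x.
  by elim: n => [//|n [oV Vx]]; have [] := shP (V n) oV Vx.
exists V; split=> //; first by move=> y Vy; exact: (Vy 0).
rewrite (_ : \bigcap_n V n = \bigcap_n closure (V n)).
  by apply: closed_bigI => n _; exact: closed_closure.
apply/seteqP; split=> [y Vy n _|y Vy n _]; first by apply: subset_closure; exact: Vy.
by have [_ _] := shP (V n) (oV n).1 (oV n).2; apply; exact: (Vy n.+1).
Qed.

(** The invariant of the tree: a singleton of this form would be a point of character at most [K] in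
    [Z]. *)
Definition closedG (K : Type) (X : topologicalType) (Z C : set X) : Prop :=
  closed C /\ exists U : K -> set X, (forall k, open (U k)) /\
    forall x, C x <-> Z x /\ forall k, U k x.

Section Tree.

Variables (K W : Type) (lt : W -> W -> Prop) (X : topologicalType) (Z : set X).
Hypotheses (wf : well_founded lt)
  (tot : forall x y, [\/ lt x y, x = y | lt y x])
  (tr : forall x y z, lt x y -> lt y z -> lt x z)
  (segK : forall w, tle {v | lt v w} K).
Hypotheses (natK : tle nat K) (KK : tle (K * K) K).
Hypotheses (cX : compact [set: X]) (hX : hausdorff_space X).
Hypotheses (clZ : closed Z) (Z0 : Z !=set0) (nZ : forall z, ~ Gpoint K Z z).

(** By [nZ] the set [C] has two points; they are separated, and each side is cut down by a countable
    intersection of open sets that is closed. *)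
Lemma closedG_split : exists sp : bool -> set X -> set X, forall C,
  closedG K Z C -> C !=set0 ->
  [/\ forall b, closedG K Z (sp b C), forall b, sp b C !=set0,
      forall b, sp b C `<=` C & sp true C `&` sp false C = set0].
Proof.
have [k0 _] := natK.
have [dec decP] := tle_enum (k0 0, 0) (tle_trans (tle_prod (tle_refl K) natK) KK).
suff /choice[f fP] (C : set X) : exists f : bool -> set X,
    closedG K Z C -> C !=set0 ->
    [/\ forall b, closedG K Z (f b), forall b, f b !=set0,
        forall b, f b `<=` C & f true `&` f false = set0].
  by exists (fun b C => f C b).
have [[GC [z Cz]]|nC] := pselect (closedG K Z C /\ C !=set0); last first.
  by exists (fun=> set0) => GC C0; case: nC.
have [clC [U [oU CU]]] := GC.
have [z' Cz' zz'] : exists2 z', C z' & z <> z'.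
  apply: contrapT => nz; apply: (nZ (z := z)); split; first by have [] := (CU z).1 Cz.
  exists U; split=> [k|y Zy Uy]; first by split=> //; exact: ((CU z).1 Cz).2.
  by apply: contrapT => yz; apply: nz; exists y; [apply/CU|exact: nesym].
have [A [B [oA oB Az Bz' AB]]] := separate_points cX hX zz'.
have sub y O : open O -> O y -> C y -> exists C' : set X,
    [/\ closedG K Z C', C' y, C' `<=` C & C' `<=` O].
  move=> oO Oy Cy; have [V [oV VO clV]] := closed_gdelta_nbhs cX hX oO Oy.
  exists (C `&` \bigcap_n V n); split.
  - split; first exact: closedI.
    exists (fun k => U (dec k).1 `&` V (dec k).2); split.
      by move=> k; apply: openI => //; exact: (oV _).1.
    move=> x; split=> [[/CU[Zx Ux] Vx]|[Zx UVx]].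
      by split=> // k; split=> //; exact: Vx.
    split=> [|n _]; last by have [k kE] := decP (k0 0, n); have := UVx k; rewrite kE => -[].
    by apply/CU; split=> // k; have [l lE] := decP (k, 0); have := UVx l; rewrite lE => -[].
  - by split=> // n _; exact: (oV n).2.
  - by move=> x [].
  - by move=> x [_ /VO].
have [C1 [G1 C1z C1C C1A]] := sub z A oA Az Cz.
have [C2 [G2 C2z C2C C2B]] := sub z' B oB Bz' Cz'.
exists (fun b : bool => if b then C1 else C2) => _ _; split.
- by case.
- by case; [exists z|exists z'].
- by case.
- apply/seteqP; split=> // x [/C1A Ax /C2B Bx].
  by rewrite -AB; split; exact: subset_closure.
Qed.

Lemma closedG_seg (w : W) (F : W -> set X) :
    (forall v, lt v w -> closedG K Z (F v)) ->
  closedG K Z [set x | Z x /\ forall v, lt v w -> F v x].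
Proof.
move=> GF; split.
  rewrite (_ : [set x | _] = Z `&` \bigcap_(v in [set v | lt v w]) F v) //.
  by apply: closedI => //; apply: closed_bigI => v /GF[].
have /choice[U UP] v : exists U : K -> set X, lt v w -> (forall k, open (U k)) /\
    forall x, F v x <-> Z x /\ forall k, U k x.
  have [/GF[_ [U UP]]|nv] := pselect (lt v w); first by exists U.
  by exists (fun=> set0) => /nv.
have [[v0 v0w]|nv] := pselect (exists v, lt v w); last first.
  exists (fun=> setT); split=> [_|x]; first exact: openT.
  by split=> -[Zx _]; split=> // v vw; case: nv; exists v.
have [k0 _] := natK.
have [g gP] := tle_enum (exist _ v0 v0w) (segK w).
have [dec decP] := tle_enum (k0 0, k0 0) KK.
exists (fun k => U (sval (g (dec k).1)) (dec k).2); split=> [k|x].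
  by have [] := UP _ (svalP (g (dec k).1)).
split=> -[Zx Fx]; split=> //; [move=> k|move=> v vw].
  have gw := svalP (g (dec k).1); have [_ /(_ x)[/(_ (Fx _ gw))[_ h] _]] := UP _ gw.
  exact: h.
have [_ UF] := UP v vw; apply/UF; split=> // k.
have [m mE] := gP (exist _ v vw); have [l lE] := decP (m, k).
by have := Fx l; rewrite lE /= mE.
Qed.

(* The Cech-Pospisil tree, with the branch b : set W choosing at node w the left
   or right half of the intersection of the previous sets. *)
Lemma cech_pospisil : exists F : set W -> W -> set X,
  [/\ forall b w, closed (F b w),
      forall b, exists x, forall w, F b w x,
      forall b c x, (forall w, F b w x) -> (forall w, F c w x) -> b = c &
      forall b c w, (forall v, lt v w \/ v = w -> (b v <-> c v)) -> F b w = F c w].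
Proof.
have [sp spP] := closedG_split.
pose F b := Fix wf (fun=> set X) (fun w rec =>
  sp `[< b w >] [set x | Z x /\ forall v (vw : lt v w), rec v vw x]).
pose I b w := [set x | Z x /\ forall v, lt v w -> F b v x].
have FE (b : set W) w : F b w = sp `[< b w >] (I b w).
  rewrite /F Fix_eq // => v f g fg.
  by congr sp; apply/funext => x; congr (_ /\ _); apply: eq_forall => u;
    apply: eq_forall => h; rewrite fg.
(* Compactness along initial segments: the set at a node lies in all earlier ones. [P] is the set of
   nodes already known to be sound, first the predecessors of a node and finally all of [W]. *)
have branch b (P : set W) :
    (forall w, P w -> [/\ closed (F b w), F b w !=set0 & F b w `<=` I b w]) ->
    exists2 x, Z x & forall w, P w -> F b w x.
  move=> FP.
  pose E (A : set W) := [set x | forall v, A v -> P v -> F b v x].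
  pose G := [set A | exists2 u, P u & A = [set v | lt v u \/ v = u]].
  have [||||x Zx Ex] := @compact_chain X W G E Z cX _ clZ Z0.
  - move=> _ _ [u _ ->] [v _ ->]; have [uv|->|vu] := tot u v.
    + by left=> x [xu|->]; left=> //; exact: tr uv.
    + by left.
    + by right=> x [xv|->]; left=> //; exact: tr vu.
  - move=> A _; rewrite (_ : E A = \bigcap_(v in A `&` P) F b v).
      by apply: closed_bigI => v [_ /FP[]].
    by apply/seteqP; split=> x xE v => [[Av Pv]|Av Pv]; apply: xE.
  - by move=> A B AB x xB v /AB; exact: xB.
  - move=> _ [u Pu ->]; have [_ [x Fx] FI] := FP u Pu; have [Zx Ix] := FI x Fx.
    by exists x; split=> // v [vu _|-> //]; exact: Ix.
  exists x => // w Pw; apply: (Ex [set v | lt v w \/ v = w]) => //; last by right.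
  by exists w.
have inv b w : [/\ closedG K Z (F b w), F b w !=set0 & F b w `<=` I b w].
  elim/(well_founded_ind wf): w => w IH.
  have GI : closedG K Z (I b w) by apply: closedG_seg => v /IH[].
  have I0 : I b w !=set0.
    have [v vw|x Zx Fx] := branch b (fun v => lt v w); last by exists x.
    by have [[clF _] F0 FI] := IH v vw.
  by have [Gsp sp0 spI _] := spP _ GI I0; rewrite FE.
have loc b c w : (forall v, lt v w \/ v = w -> (b v <-> c v)) -> F b w = F c w.
  elim/(well_founded_ind wf): w => w IH bc; rewrite !FE.
  have -> : `[< b w >] = `[< c w >] by apply: asbool_equiv_eq; apply: bc; right.
  congr sp; apply/funext => x; congr (_ /\ _); apply: eq_forall => v.
  apply/propext; split=> h vw; have := h vw; rewrite (IH v vw) // => u uv;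
    apply: bc; left; case: uv => [uv|->//]; exact: tr vw.
exists F; split=> //.
- by move=> b w; have [[]] := inv b w.
- move=> b; have [w _|x _ Fx] := branch b setT; last by exists x => w; exact: Fx.
  by have [[? _] ? ?] := inv b w.
- move=> b c x bx cx; apply: contrapT => bc.
  (* At the first difference the preceding intersections agree, and the two halves chosen are
     disjoint. *)
  have [|w bcw bcmin] := @wf_min _ _ (fun w => ~ (b w <-> c w)) wf.
    apply: contrapT => nw; apply: bc; apply/funext => w; apply/propext.
    by apply: contrapT => bcw; apply: nw; exists w.
  have Ibc : I b w = I c w.
    apply/funext => y; congr (_ /\ _); apply: eq_forall => v.
    apply/propext; split=> h vw; have := h vw; rewrite (loc b c v) // => u uv;
      apply: contrapT; apply: bcmin; case: uv => [uv|->//]; exact: tr vw.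
  have GI : closedG K Z (I c w) by apply: closedG_seg => v _; have [] := inv c v.
  have [_ _ cI] := inv c w.
  have [_ _ _ spD] := spP _ GI (ex_intro _ x (cI _ (cx w))).
  have := bx w; have := cx w; rewrite !FE Ibc.
  have dis : sp true (I c w) x -> sp false (I c w) x -> False.
    by move=> tx fx; have : (sp true (I c w) `&` sp false (I c w)) x by []; rewrite spD.
  case: (asboolP (b w)) => bw; case: (asboolP (c w)) => cw.
  - by case: bcw.
  - by move=> fx tx; exact: dis.
  - by move=> tx fx; exact: dis.
  - by case: bcw.
Qed.

End Tree.

(** The set at node [w] depends only on the branch up to [w], which an enumeration of that segment
    codes by a subset of [K]; so the sets of all branches are indexed by [W * set K].
    [discrete_cover_trace] gives each branch a finite code, and branches with equal codes share a
    point, hence coincide. *)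
Lemma branches_tle (K W J : Type) (lt : W -> W -> Prop) (X : topologicalType)
    (D : J -> set X) :
    well_founded lt -> (forall x y, [\/ lt x y, x = y | lt y x]) ->
    (forall x y z, lt x y -> lt y z -> lt x z) ->
    (forall w, tle {v | lt v w} K) -> tle nat K -> tle (K * K) K ->
    compact [set: X] -> hausdorff_space X ->
    ~ (forall Z : set X, closed Z -> Z !=set0 -> exists z, Gpoint K Z z) ->
    (forall j, discrete_subset (D j)) -> (forall x, exists j, D j x) ->
  tle (set W) (seq J * seq (W * set K)).
Proof.
move=> wf tot tr segK natK KK cX hX nHK dD covD.
have [Z [clZ Z0 nZ]] : exists Z : set X, [/\ closed Z, Z !=set0 &
    forall z, ~ Gpoint K Z z].
  apply: contrapT => nZ; apply: nHK => Z clZ Z0; apply: contrapT => nz.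
  by apply: nZ; exists Z; split=> // z Gz; apply: nz; exists z.
have [F [clF F0 Fdis Floc]] := cech_pospisil wf tot tr segK natK KK cX hX clZ Z0 nZ.
have /choice[e eP] w : exists e : K -> W, forall v, lt v w \/ v = w -> exists k, e k = v.
  have unitK : tle unit K by have [k0 _] := natK; exists (fun=> k0 0) => -[] [].
  have [d dS] := tle_enum (inr tt) (sum_tle natK KK (segK w) unitK).
  exists (fun k => if d k is inl v then sval v else w) => v [vw|->].
    by have [k kE] := dS (inl (exist _ v vw)); exists k; rewrite kE.
  by have [k kE] := dS (inr tt); exists k; rewrite kE.
pose G (i : W * set K) := F [set v | exists2 k, i.2 k & e i.1 k = v] i.1.
pose P (b : set W) : set (W * set K) := [set i | i.2 = [set k | b (e i.1 k)]].
have GP b i : P b i -> G i = F b i.1.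
  move=> Pi; apply: Floc => v /eP[k kv]; rewrite Pi; split=> [[l /= bl <-//]|bv].
  by exists k => //=; rewrite kv.
have /choice[c cP] b : exists s : seq J * seq (W * set K),
    (exists x, capl (closure \o D) s.1 x /\ capl G s.2 x) /\
    forall x, capl (closure \o D) s.1 x -> capl G s.2 x -> forall i, P b i -> G i x.
  apply: discrete_cover_trace => //; first by move=> i; exact: clF.
  by have [x Fx] := F0 b; exists x => i /GP ->.
have GF b x : (forall i, P b i -> G i x) -> forall w, F b w x.
  by move=> Gx w; have Pw : P b (w, [set k | b (e w k)]) by []; have := Gx _ Pw; rewrite (GP b).
exists c => a b ab; have [[x [xD xG]] ca] := cP a; have [_ cb] := cP b.
apply: (Fdis a b x); apply: GF; first exact: ca.
by apply: cb; rewrite -ab.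
Qed.

(** * The cases of character omega and omega_1 under CH *)

Theorem theorem2p30 (X : topologicalType) (hCH : CH)
    (X0 : [set: X] !=set0) (cX : compactum X) (phX : power_homogeneous X) :
  card_min (Delta X) (omega 3) #<= dis X.
Proof.
have {cX}[cX hX] := cX; have [x0 _] := X0.
have [disD disC _] := disP X.
pose J := set_type (dis X); pose D (j : J) := val j.
have dD (j : J) : discrete_subset (D j) by apply: disD; exact: set_valP.
have covD x : exists j, D j x.
  have [A disA Ax] : (\bigcup_(A in dis X) A) x by rewrite disC.
  by exists (SigSub (mem_set disA)).
have [j0 _] := covD x0.
rewrite card_min_le; apply/orP.
have [[x ox]|crowded] := pselect (exists x : X, open [set x]).
  left; have [_ _ Dmin] := DeltaP X0.
  apply: card_le_trans (Dmin [set x] ox (ex_intro _ x erefl)) _.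
  apply/card_leE; exists (fun=> j0) => a b _; apply: val_inj.
  by rewrite (set_valP a) (set_valP b).
have small (A : Type) : tle A (set_type (dis X)) -> tle X A -> Delta X #<= dis X.
  move=> AJ XA; apply: card_le_trans (card_leT _) _; apply/card_leE.
  apply: tle_trans (tle_trans XA AJ).
  by exists val; exact: val_inj.
(* Under CH, [K1] has size both 2^omega and omega_1. *)
pose K1 := set nat.
have natK1 : tle nat K1 := tle_singletons nat.
have K1K1 : tle (K1 * K1) K1 := set_square (bool_tle (tle_refl nat)) nat_square.
have [K1o oK1] : tle K1 (omega 1) /\ tle (omega 1) K1.
  have /card_eqPle[/card_leE h1 /card_leE h2] := hCH.
  by split; [apply: tle_trans h1|apply: tle_trans h2 _];
    [exists (fun x => SigSub (mem_set (Logic.I : setT x))) => a b /(congr1 val)|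
     exists val; exact: val_inj].
have K1J : tle K1 J.
  apply: tle_trans K1o _; apply/card_leE/card_succ_le => /card_leE Jnat.
  have {}Jnat : tle J nat.
    by apply: tle_trans Jnat _; exists val; exact: val_inj.
  have [g gP] := tle_enum j0 Jnat.
  have [|x xD] := uncountable_dis cX hX X0 _ (fun n => dD (g n)).
    by move=> x ox; apply: crowded; exists x.
  have [j jx] := covD x; have [n ng] := gP j.
  by apply: (xD n); rewrite ng.
(* In the first case the size of [X] is at most 2^omega, hence at most [dis X]. *)
have [H0|nH0] := pselect (forall Z : set X, closed Z -> Z !=set0 ->
    exists z, Gpoint nat Z z).
  left; apply: (small K1) => //; apply: Gpoint_tle nat_square _ => //.
    exact: tle_refl.
  by apply: power_homogeneous_Gpoint nat_square H0 phX => //; exact: tle_refl.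
have [dis2|/card_succ_le] := pselect (dis X #<= omega 2); last by right.
have seqK1 : tle (seq K1) K1 := seq_tle natK1 K1K1.
have [W1 [lt1 [[wf1 tot1 tr1] seg1 W1o oW1]]] := succ_well_order (omega 0).
have W1K1 : tle W1 K1 := tle_trans W1o oK1.
have K1W1 : tle K1 W1 := tle_trans K1o oW1.
have set1 : tle (set W1) (seq J * seq (W1 * K1)).
  apply: (branches_tle wf1 tot1 tr1) nat_square cX hX nH0 dD covD => //.
    move=> w; apply: tle_trans (seg1 w) _; exists val; exact: val_inj.
  exact: tle_refl.
have seqW1 : tle (seq (W1 * K1)) K1.
  exact: tle_trans (tle_seq (tle_trans (tle_prod W1K1 (tle_refl _)) K1K1)) seqK1.
(* Were [dis X] at most omega_1, [set1] would give 2^omega_1 <= omega_1. *)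
have o2J : tle (omega 2) J.
  apply/card_leE/card_succ_le => /card_leE Jo1.
  apply: (@cantor_tle K1); apply: tle_trans (tle_set K1W1) (tle_trans set1 _).
  apply: tle_trans (tle_prod (tle_trans (tle_seq _) seqK1) seqW1) K1K1.
  exact: tle_trans Jo1 oK1.
have [W2 [lt2 [[wf2 tot2 tr2] seg2 W2o oW2]]] := succ_well_order (omega 1).
have K1W2 : tle K1 W2.
  have [//|W2K1] := tle_total K1 W2.
  case: (@card_succ_nle _ (omega 1)); apply/card_leE.
  exact: tle_trans oW2 (tle_trans W2K1 K1o).
have seg2' w : tle {v | lt2 v w} K1 := tle_trans (seg2 w) oK1.
have W2W2 : tle (W2 * W2) W2 := well_order_square natK1 K1K1 K1W2 tot2 seg2'.
have seqW2 : tle (seq W2) W2 := seq_tle (tle_trans natK1 K1W2) W2W2.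
have JW2 : tle J W2 by apply: tle_trans oW2; apply/card_leE.
have seqJ : tle (seq J) W2 := tle_trans (tle_seq JW2) seqW2.
(* Now [dis X] has size omega_2, so [set1] gives 2^omega_1 <= omega_2. *)
have setK1 : tle (set K1) W2.
  apply: tle_trans (tle_set K1W1) (tle_trans set1 (tle_trans (tle_prod seqJ _) W2W2)).
  exact: tle_trans seqW1 K1W2.
(* In the first case the size of [X] is at most 2^omega_1, hence at most omega_2 and [dis X]; in the
   second the tree of height omega_2 would give 2^omega_2 <= omega_2. *)
have [H1|nH1] := pselect (forall Z : set X, closed Z -> Z !=set0 ->
    exists z, Gpoint K1 Z z).
  left; apply: (small (set K1)).
    exact: tle_trans setK1 (tle_trans W2o o2J).
  apply: (Gpoint_tle cX hX natK1 K1K1).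
  exact: (power_homogeneous_Gpoint cX hX natK1 K1K1 H1 phX).
case: (@cantor_tle W2).
have := branches_tle wf2 tot2 tr2 seg2' natK1 K1K1 cX hX nH1 dD covD.
move=> /tle_trans; apply; apply: (tle_trans (tle_prod seqJ _) W2W2).
exact: tle_trans (tle_seq (tle_trans (tle_prod (tle_refl _) setK1) W2W2)) seqW2.
Qed.
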